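(* Let $k\ge 2$ and let $\mathcal{H}$ be a $k$-uniform hypergraph. If $\mathcal{E}(\mathcal{H})$ is a rational number, then $\mathcal{E}(\mathcal{H})$ is an even integer.
   Context: A hypergraph $\mathcal{H}=(V,E)$ consists of a finite vertex set $V$ and a set $E$ of edges, each edge being a subset of $V$ of cardinality at least $2$ (distinct edges are distinct subsets). It is $k$-uniform if every edge has exactly $k$ vertices. For $i\neq j$ in $V$, $d(\{i,j\})$ denotes the number of edges containing both $i$ and $j$. The adjacency matrix $\mathbf{A}(\mathcal{H})$ is the $|V|\times|V|$ matrix with zero diagonal and $(i,j)$ entry $d(\{i,j\})$ for $i\neq j$. The (adjacency) energy is $\mathcal{E}(\mathcal{H})=\sum_{i=1}^{n}|\lambda_i|$, where $\lambda_1,\dots,\lambda_n$ are the eigenvalues of $\mathbf{A}(\mathcal{H})$ (with multiplicity). *)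

(* Defs.v *)
(* Eigenvalues live in algC, which contains all the eigenvalues of an
   integer matrix. *)
From HB Require Import structures.
From mathcomp Require Import all_boot all_order all_algebra all_field.

Set Implicit Arguments.
Unset Strict Implicit.
Unset Printing Implicit Defensive.

Import Order.TTheory GRing.Theory Num.Theory.

Local Open Scope ring_scope.

Record hypergraph (V : finType) := Hypergraph {
  edges : {set {set V}};
  edges_card : forall e, e \in edges -> (2 <= #|e|)%N }.

Definition uniform (V : finType) (k : nat) (H : hypergraph V) : Prop :=
  forall e, e \in edges H -> #|e| = k.

Definition codegree (V : finType) (H : hypergraph V) (i j : V) : nat :=
  #|[set e in edges H | (i \in e) && (j \in e)]|.

(* Vertices are numbered by enum_val : 'I_#|V| -> V. *)
Definition adjacency_mx (V : finType) (H : hypergraph V) : 'M[algC]_#|V| :=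
  \matrix_(i, j)
    if i == j then 0 else (codegree H (enum_val i) (enum_val j))%:R.

(* The n eigenvalues, repeated according to algebraic multiplicity. *)
Definition eigenvalues (n : nat) (A : 'M[algC]_n) : seq algC :=
  sval (closed_field_poly_normal (char_poly A)).

Lemma char_poly_eigenvalues (n : nat) (A : 'M[algC]_n) :
  char_poly A = \prod_(a <- eigenvalues A) ('X - a%:P).
Proof.
rewrite /eigenvalues; case: closed_field_poly_normal => s /= Ds.
by rewrite {1}Ds (monicP (char_poly_monic A)) scale1r.
Qed.

Definition energy (V : finType) (H : hypergraph V) : algC :=
  \sum_(a <- eigenvalues (adjacency_mx H)) `|a|.

(* Main.v *)
Require Import Defs.
From mathcomp Require Import all_boot all_order all_algebra all_field.
Import GRing.Theory Num.Theory.
Local Open Scope ring_scope.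

(** The adjacency matrix is an integer symmetric matrix with zero diagonal, so
    its eigenvalues are real algebraic integers with sum 0.  Hence the energy is
    twice the sum of the nonnegative eigenvalues, and that sum is an algebraic
    integer; if it is rational, it is an integer. *)

(** For a row eigenvector [v] with conjugate [w], evaluating [v *m A *m w^T] from the left and, by
    symmetry, from the right gives [a] and [a^*] times the same scalar [v *m w^T]. *)
Lemma eigenvalue_sym_real (C : numClosedFieldType) (n : nat) (A : 'M[C]_n)
    (a : C) :
  A^T = A -> (forall i j, A i j \is Num.real) -> eigenvalue A a ->
  a \is Num.real.
Proof.
move=> symA realA /eigenvalueP[v vA v_neq0].
have AC : map_mx Num.conj A = A.
  by apply/matrixP=> i j; rewrite mxE; apply/CrealP/realA.
pose w := map_mx Num.conj v.
have wA : w *m A = a^* *: w.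
  by rewrite -{1}AC -map_mxM vA map_mxZ.
have eq_a : a *: (v *m w^T) = a^* *: (v *m w^T).
  by rewrite scalemxAl -vA -mulmxA -{1}symA -trmx_mul wA linearZ /= scalemxAr.
(* This entry is the squared Hermitian norm of the nonzero [v], so it can be cancelled. *)
have: 0 < (v *m w^T) 0 0 by rewrite map_trmx -dotmxE dotmx_is_dotmx.
move=> /lt0r_neq0 vw_neq0; apply/CrealP.
move/matrixP/(_ 0 0): eq_a; rewrite [LHS]mxE [RHS]mxE.
by move/(mulIf vw_neq0).
Qed.

Lemma mem_eigenvalues (n : nat) (A : 'M[algC]_n) (a : algC) :
  (a \in eigenvalues A) = eigenvalue A a.
Proof.
by rewrite eigenvalue_root_char char_poly_eigenvalues root_prod_XsubC.
Qed.

Lemma size_eigenvalues (n : nat) (A : 'M[algC]_n) : size (eigenvalues A) = n.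
Proof.
by apply: succn_inj; rewrite -(size_char_poly A) char_poly_eigenvalues
  size_prod_XsubC.
Qed.

(** Both sides are minus the coefficient of degree [n - 1] in [char_poly A]; the case [n = 0], which
    has no such coefficient, is treated apart. *)
Lemma sum_eigenvalues (n : nat) (A : 'M[algC]_n) :
  \sum_(a <- eigenvalues A) a = \tr A.
Proof.
case: n A => [|n] A.
  by rewrite (size0nil (size_eigenvalues _ A)) big_nil /mxtrace big_ord0.
apply: oppr_inj; rewrite -char_poly_trace // -coefPn_prod_XsubC.
  by rewrite size_eigenvalues -char_poly_eigenvalues.
by rewrite size_eigenvalues.
Qed.

(** The characteristic polynomial is monic with integer coefficients. *)
Lemma eigenvalue_int_Aint (n : nat) (B : 'M[int]_n) (a : algC) :
  eigenvalue (map_mx intr B) a -> a \in Aint.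
Proof.
rewrite eigenvalue_root_char => /root_monic_Aint; apply.
  exact: char_poly_monic.
by rewrite -map_char_poly; apply/polyOverP=> i; rewrite coef_map /= intr_int.
Qed.

(** Adding the zero sum turns each term into [|a| + a], which is [2 * a] if [0 <= a] and [0]
    otherwise. *)
Lemma sum_norm_real (R : numDomainType) (s : seq R) :
  {in s, forall a, a \is Num.real} -> \sum_(a <- s) a = 0 ->
  \sum_(a <- s) `|a| = 2 * \sum_(a <- s | 0 <= a) a.
Proof.
move=> real_s sum0.
rewrite -[LHS]addr0 -[X in _ + X]sum0 -big_split /= mulr_sumr [RHS]big_mkcond.
apply: eq_big_seq => a /real_s /real_ge0P[] a_cmp0.
  by rewrite mulr_natl mulr2n.
exact: addNr.
Qed.

Section Adjacency.

Variables (V : finType) (H : hypergraph V).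

Lemma adjacency_mx_sym : (adjacency_mx H)^T = adjacency_mx H.
Proof.
apply/matrixP=> i j; rewrite !mxE eq_sym /codegree.
case: eqP => // _; congr _%:R; apply: eq_card => e.
by rewrite !inE [X in _ && X]andbC.
Qed.

Lemma adjacency_mx_int :
  exists B : 'M[int]_#|V|, adjacency_mx H = map_mx intr B.
Proof.
exists (\matrix_(i, j)
  if i == j then 0 else (codegree H (enum_val i) (enum_val j))%:R).
by apply/matrixP=> i j; rewrite !mxE; case: eqP; rewrite // rmorph_nat.
Qed.

Lemma adjacency_mx_trace : \tr (adjacency_mx H) = 0.
Proof. by apply: big1 => i _; rewrite mxE eqxx. Qed.

Lemma adjacency_eigenvalue_real (a : algC) :
  eigenvalue (adjacency_mx H) a -> a \is Num.real.
Proof.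
apply: eigenvalue_sym_real; first exact: adjacency_mx_sym.
by move=> i j; rewrite mxE; case: eqP; rewrite ?realn.
Qed.

Lemma adjacency_eigenvalue_Aint (a : algC) :
  eigenvalue (adjacency_mx H) a -> a \in Aint.
Proof. by have [B ->] := adjacency_mx_int; apply: eigenvalue_int_Aint. Qed.

End Adjacency.

Theorem theorem8 (V : finType) (k : nat) (H : hypergraph V)
    (hk : (2 <= k)%N) (Hk : uniform k H) :
  energy H \in Crat -> exists m : int, energy H = (2 * m)%:~R.
Proof.
set s := eigenvalues (adjacency_mx H).
have energyE : energy H = 2 * \sum_(a <- s | 0 <= a) a.
  apply: sum_norm_real; last by rewrite sum_eigenvalues adjacency_mx_trace.
  by move=> a; rewrite mem_eigenvalues; apply: adjacency_eigenvalue_real.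
rewrite energyE => ratE.
have /intrP[m ->] : \sum_(a <- s | 0 <= a) a \is a Num.int.
  (* A rational algebraic integer is an integer. The sum is rational because it is half the
     energy. *)
  apply: Cint_rat_Aint.
    rewrite -[X in X \in _](mulKf (x := 2)) ?pnatr_eq0 //.
    by rewrite rpredM // rpredV rpred_nat.
  rewrite big_seq_cond; apply: rpred_sum => a /andP[].
  by rewrite mem_eigenvalues => /adjacency_eigenvalue_Aint.
by exists m; rewrite intrM.
Qed.
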